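(* Let $\alpha$ be an entropy rank one $\mathbb{Z}^d$-action by continuous automorphisms of a compact metrizable abelian zero-dimensional group $X$. Then there is a constant $C>0$ such that for all $\mathbf{n}\in\mathbb{Z}^d$ for which $\alpha^{\mathbf{n}}$ is ergodic, \[\mathsf{F}_\alpha(\mathbf{n})\leqslant C^{\|\mathbf{n}\|},\] where $\|\cdot\|$ is the Euclidean norm.
   Context: Entropy rank one: every $\alpha^{\mathbf{n}}$ has finite topological entropy. $\mathsf{F}_\alpha(\mathbf{n})$ is the number of $x\in X$ with $\alpha^{\mathbf{n}}(x)=x$. Ergodicity is with respect to Haar measure. *)

(* Defs.v *)
From HB Require Import structures.
From mathcomp Require Import all_boot all_order all_algebra.
From mathcomp Require Import all_classical all_reals all_analysis.

Set Implicit Arguments.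
Unset Strict Implicit.
Unset Printing Implicit Defensive.

Import Order.TTheory GRing.Theory Num.Theory.
Local Open Scope classical_set_scope.
Local Open Scope ring_scope.

Section Defs.
Variable R : realType.
Variable X : topologicalZmodType.

Definition metrizable : Prop :=
  exists dist : X -> X -> R,
    [/\ (forall x y, 0 <= dist x y),
        (forall x y, dist x y = 0 <-> x = y),
        (forall x y, dist x y = dist y x),
        (forall x y z, dist x z <= dist x y + dist y z) &
        (forall A : set X, open A <->
           (forall x, A x -> exists2 e : R, 0 < e & [set y | dist x y < e] `<=` A))].

Definition zero_dim_clopen_base : Prop :=
  forall (x : X) (U : set X), open U -> U x ->
    exists V : set X, [/\ open V, closed V, V x & V `<=` U].

Definition open_cover (U : set (set X)) : Prop :=
  (forall A, U A -> open A) /\ (forall x : X, exists2 A, U A & A x).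

(* N(U v T^-1 U v ... v T^-(n-1) U): minimal cardinality of a subcover of the join *)
Definition join_cover_number (T : X -> X) (U : set (set X)) (n : nat) : R :=
  inf [set (k%:R : R) | k in [set k : nat |
        exists w : 'I_k -> 'I_n -> set X,
          (forall j i, U (w j i)) /\
          (forall x : X, exists j, forall i : 'I_n, w j i (iter i T x))]].

Definition topological_entropy (T : X -> X) : \bar R :=
  ereal_sup [set limn_esup (fun n : nat => (ln (join_cover_number T U n) / n%:R)%:E)
            | U in open_cover].

Definition Zd_action_by_cont_automorphisms (d : nat)
    (alpha : 'rV[int]_d -> X -> X) : Prop :=
  [/\ (forall x, alpha 0 x = x),
      (forall m n x, alpha (m + n) x = alpha m (alpha n x)),
      (forall n x y, alpha n (x + y) = alpha n x + alpha n y) &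
      (forall n, continuous (alpha n))].

Definition entropy_rank_one (d : nat) (alpha : 'rV[int]_d -> X -> X) : Prop :=
  forall n, (topological_entropy (alpha n) < +oo)%E.

Definition pointedX : Type := X.
HB.instance Definition _ := Choice.on pointedX.
HB.instance Definition _ := isPointed.Build pointedX (0 : X).
Local Notation borelX := (g_sigma_algebraType (@open X : set (set pointedX))).

Definition haar_probability (mu : {measure set borelX -> \bar R}) : Prop :=
  mu [set: borelX] = 1%E /\
  forall (x : X) (A : set borelX), measurable A ->
    mu ((fun y : X => x + y) @^-1` A) = mu A.

Definition ergodic_wrt (mu : {measure set borelX -> \bar R}) (T : X -> X) : Prop :=
  forall A : set borelX, measurable A -> T @^-1` A = A ->
    mu A = 0%E \/ mu A = 1%E.

Definition haar_ergodic (T : X -> X) : Prop :=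
  forall mu : {measure set borelX -> \bar R}, haar_probability mu -> ergodic_wrt mu T.

End Defs.

Definition euclid_norm (R : realType) (d : nat) (n : 'rV[int]_d) : R :=
  Num.sqrt (\sum_(i < d) ((n ord0 i)%:~R : R) ^+ 2).

(* Main.v *)
(* Entropy is measured by indices: for an open subgroup U let U_L be the set of x
   with x, T x, ..., T^(L-1) x in U; then [X : U_L] grows like q(U)^L for an
   integer q(U) with ln q(U) <= h(T).

   Let T = alpha^n0 be ergodic, so that x |-> T^k x - x is onto for k > 0, and let
   U0 maximize q. For U inside U0 the indices [U0_L : U_L] are then bounded in L,
   so a pigeonhole argument produces g = T^D (T^(D!) - 1), surjective and commuting
   with the action, which maps U0_L into U for L large. The subgroup V = g(U0_L)
   lies inside U, while [V : V `&` alpha^(-m) V] is at most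
   [U0_L : (U0 `&` alpha^(-m) U0)_L], which is bounded independently of U and L.

   The quantity r(m) = [V : V `&` alpha^(-m) V] is submultiplicative in m, whence
   r(n) <= K^(|n_1| + ... + |n_d|) with K independent of V. When alpha^n is
   ergodic, x |-> alpha^n x - x is onto, which forces any finite set of fixed
   points separated by V to have at most r(n) elements.

   That ergodicity gives surjectivity requires a Haar measure to exist; it is
   obtained by extending the coset-counting content on clopen sets. *)

Require Import Defs.
From HB Require Import structures.
From mathcomp Require Import all_boot all_order all_algebra.
From mathcomp Require Import all_classical all_reals all_analysis.
Import Order.TTheory GRing.Theory Num.Theory.
Local Open Scope classical_set_scope.
Local Open Scope ring_scope.

(** * Indices of subgroups *)

Section Index.
Context {X : zmodType}.
Implicit Types (U V W : set X) (s t : seq X).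

Definition is_subgroup V := V 0 /\ forall x y, V x -> V y -> V (x - y).

Definition separated_mod V s :=
  forall x y, x \in s -> y \in s -> V (x - y) -> x = y.

Definition transversal W V s :=
  [/\ uniq s, (forall x, x \in s -> W x), separated_mod V s &
      (forall x, W x -> exists2 y, y \in s & V (x - y))].

Definition finite_index V :=
  exists t, forall x, exists2 y, y \in t & V (x - y).

Definition fi_subgroup V := is_subgroup V /\ finite_index V.

(* The junk value is 0 when W has no finite transversal modulo V. *)
Definition sgindex W V : nat :=
  xget 0%N [set k | exists2 s, transversal W V s & size s = k].

Lemma subgroup0 V : is_subgroup V -> V 0. Proof. by case. Qed.

Lemma subgroupB V x y : is_subgroup V -> V x -> V y -> V (x - y).
Proof. by case=> _; apply. Qed.

Lemma subgroupN V x : is_subgroup V -> V x -> V (- x).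
Proof. by move=> sV Vx; rewrite -sub0r; apply: subgroupB => //; case: sV. Qed.

Lemma subgroupD V x y : is_subgroup V -> V x -> V y -> V (x + y).
Proof.
by move=> sV Vx Vy; rewrite -[y]opprK; apply: subgroupB => //; apply: subgroupN.
Qed.

Lemma subgroup_sub_trans V x y z :
  is_subgroup V -> V (x - y) -> V (y - z) -> V (x - z).
Proof.
move=> sV Vxy Vyz; have -> : x - z = (x - y) + (y - z) by rewrite addrA subrK.
exact: subgroupD.
Qed.

Lemma subgroup_subC V x y : is_subgroup V -> V (x - y) -> V (y - x).
Proof. by move=> sV Vxy; rewrite -opprB; apply: subgroupN. Qed.

Lemma subgroupT : is_subgroup [set: X]. Proof. by []. Qed.

Lemma subgroupI V W : is_subgroup V -> is_subgroup W -> is_subgroup (V `&` W).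
Proof.
move=> sV sW; split; first by split; apply: subgroup0.
by move=> x y [? ?] [? ?]; split; apply: subgroupB.
Qed.

(** Choosing for each element of [s] a congruent one in [t] is injective by separation. The index
    estimates below all rest on this. *)
Lemma separated_size_le V s t : is_subgroup V -> uniq s -> separated_mod V s ->
  (forall x, x \in s -> exists2 y, y \in t & V (x - y)) -> (size s <= size t)%N.
Proof.
move=> sV us seps cov.
have /choice[f fP] x : exists y, x \in s -> y \in t /\ V (x - y).
  have [/cov[y yt Vxy]|] := boolP (x \in s); first by exists y.
  by exists 0.
have uf : uniq [seq f x | x <- s].
  rewrite map_inj_in_uniq // => x y xs ys fxy.
  have [_ Vx] := fP x xs; have [_ Vy] := fP y ys.
  apply: seps => //; apply: subgroup_sub_trans Vx _ => //.
  by rewrite fxy; exact: subgroup_subC.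
rewrite -(size_map f); apply: uniq_leq_size => // _ /mapP[x xs ->].
by have [] := fP x xs.
Qed.

Lemma transversal_size W V s t : is_subgroup V ->
  transversal W V s -> transversal W V t -> size s = size t.
Proof.
move=> sV [us sW seps covs] [ut tW sept covt]; apply/eqP.
by rewrite eqn_leq; apply/andP; split;
  apply: (separated_size_le V) => // x ?; [apply/covt/sW|apply/covs/tW].
Qed.

(** A longest [V]-separated list in [W] is a transversal; lengths are bounded by that of a list
    meeting every coset of [V]. *)
Lemma transversal_exists W V : fi_subgroup V -> exists s, transversal W V s.
Proof.
move=> [sV [t covt]].
pose P n := `[< exists s, [/\ uniq s, (forall x, x \in s -> W x),
  separated_mod V s & size s = n] >].
have P0 : P 0%N by apply/asboolP; exists [::]; split.
have bP n : P n -> (n <= size t)%N.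
  by move/asboolP=> [s [us _ seps <-]]; apply: (separated_size_le V).
case: (ex_maxnP (ex_intro (fun n => is_true (P n)) 0%N P0) bP) => n /asboolP[s [us sW seps szs]] nmax.
exists s; split=> // x Wx; apply: contrapT => nx.
have xV y : y \in s -> ~ V (x - y) by move=> ys Vxy; apply: nx; exists y.
suff: P n.+1 by move/nmax; rewrite ltnn.
apply/asboolP; exists (x :: s); split=> [|y|y z|].
- rewrite /= us andbT; apply/negP => /xV; apply.
  by rewrite subrr; exact: subgroup0.
- by rewrite inE => /predU1P[->//|/sW].
- rewrite !inE => /predU1P[->|ys] /predU1P[->|zs] // Vyz.
  + by have := xV _ zs Vyz.
  + by have := xV _ ys (subgroup_subC _ _ _ sV Vyz).
  + exact: seps.
- by rewrite /= szs.
Qed.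

Lemma index_transversal W V s : is_subgroup V -> transversal W V s ->
  sgindex W V = size s.
Proof.
move=> sV tvs; rewrite /sgindex; case: xgetP => [k _ [t tvt <-]|].
  exact: transversal_size tvt tvs.
by move/(_ (size s))/(_ (ex_intro2 _ _ s tvs erefl)).
Qed.

Lemma index_gt0 V W : W 0 -> fi_subgroup V -> (0 < sgindex W V)%N.
Proof.
move=> W0 fV; have [s ts] := transversal_exists W V fV.
rewrite (index_transversal _ _ _ fV.1 ts); case: ts => _ _ _ /(_ _ W0)[y].
by case: s.
Qed.

Lemma separated_le_index W V s : fi_subgroup V -> uniq s ->
  (forall x, x \in s -> W x) -> separated_mod V s -> (size s <= sgindex W V)%N.
Proof.
move=> fV us sW seps; have [t tvt] := transversal_exists W V fV.
rewrite (index_transversal _ _ _ fV.1 tvt); case: tvt => _ _ _ covt.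
by apply: (separated_size_le V) => // [|x /sW/covt]; first exact: fV.1.
Qed.

Lemma index_le_cover W V t : fi_subgroup V ->
  (forall x, W x -> exists2 y, y \in t & V (x - y)) -> (sgindex W V <= size t)%N.
Proof.
move=> fV covt; have [s tvs] := transversal_exists W V fV.
rewrite (index_transversal _ _ _ fV.1 tvs); case: tvs => us sW seps _.
by apply: (separated_size_le V) => // [|x /sW/covt]; first exact: fV.1.
Qed.

Lemma transversal_mul U V W s t : is_subgroup U -> is_subgroup V ->
  is_subgroup W -> U `<=` V -> V `<=` W ->
  transversal W V s -> transversal V U t ->
  transversal W U [seq x + y | x <- s, y <- t].
Proof.
move=> sU sV sW UV VW [us ssW seps covs] [ut tV sept covt].
have eqs x1 y1 x2 y2 : x1 \in s -> y1 \in t -> x2 \in s -> y2 \in t ->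
    U (x1 + y1 - (x2 + y2)) -> x1 = x2 /\ y1 = y2.
  move=> x1s y1t x2s y2t; rewrite opprD addrACA => Uxy.
  have x12 : x1 = x2.
    apply: seps => //; rewrite -[x1 - x2](addrK (y1 - y2)).
    apply: subgroupB => //; first exact: UV.
    by apply: subgroupB => //; exact: tV.
  by move: Uxy; rewrite x12 subrr add0r => /sept ->.
split.
- apply: allpairs_uniq => // -[x1 y1] [x2 y2] /allpairsP[[a b] [/= sa tb [-> ->]]].
  move=> /allpairsP[[c e] [/= sc te [-> ->]]] /= eqxy.
  have [| -> ->] // := eqs a b c e sa tb sc te.
  by rewrite eqxy subrr; exact: subgroup0.
- move=> _ /allpairsP[[x y] [/= xs yt ->]].
  by apply: subgroupD => //; [exact: ssW|exact/VW/tV].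
- move=> _ _ /allpairsP[[x1 y1] [/= ? ? ->]] /allpairsP[[x2 y2] [/= ? ? ->]].
  by move=> /eqs[] // -> ->.
- move=> x /covs[y ys Vxy]; have [z zt Uz] := covt _ Vxy.
  by exists (y + z); [exact: allpairs_f|rewrite opprD addrA].
Qed.

Lemma index_mul U V W : fi_subgroup U -> is_subgroup V ->
  is_subgroup W -> U `<=` V -> V `<=` W ->
  sgindex W U = (sgindex W V * sgindex V U)%N.
Proof.
move=> fU sV sW UV VW.
have fV : fi_subgroup V.
  by split=> //; have [t tU] := fU.2; exists t => x; have [y yt /UV] := tU x; exists y.
have [s ts] := transversal_exists W V fV.
have [t tt] := transversal_exists V U fU.
have tst := transversal_mul _ _ _ _ _ fU.1 sV sW UV VW ts tt.
rewrite (index_transversal _ _ _ _ tst) ?(index_transversal _ _ _ _ ts) //;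
  last exact: fU.1.
by rewrite (index_transversal _ _ _ fU.1 tt) size_allpairs.
Qed.

Lemma fi_subgroupS V W : is_subgroup W -> fi_subgroup V -> V `<=` W ->
  fi_subgroup W.
Proof.
move=> sW [sV [t tV]] VW; split=> //; exists t => x.
by have [y yt /VW] := tV x; exists y.
Qed.

Lemma fi_subgroupI V W : fi_subgroup V -> fi_subgroup W ->
  fi_subgroup (V `&` W).
Proof.
move=> fV fW; split; first by apply: subgroupI; [exact: fV.1|exact: fW.1].
have [t tt] := transversal_exists V W fW.
have [s ts] := fV.2; exists [seq x + y | x <- s, y <- t] => x.
have [y ys Vxy] := ts x; have [z zt Wz] : exists2 z, z \in t & W (x - y - z).
  by case: tt => _ _ _; apply.
exists (y + z); first exact: allpairs_f.
rewrite opprD addrA; split=> //; apply: subgroupB => //; first exact: fV.1.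
by case: tt => _ + _ _; apply.
Qed.

Section Morphism.
Variable f : X -> X.
Hypothesis fD : {morph f : x y / x + y}.

Lemma morph0 : f 0 = 0.
Proof. by apply: (addrI (f 0)); rewrite -fD !addr0. Qed.

Lemma morphN : {morph f : x / - x}.
Proof. by move=> x; apply: (addrI (f x)); rewrite -fD !subrr morph0. Qed.

Lemma morphB : {morph f : x y / x - y}.
Proof. by move=> x y; rewrite fD morphN. Qed.

Lemma subgroup_preimage V : is_subgroup V -> is_subgroup (f @^-1` V).
Proof.
move=> sV; split=> [|x y Vx Vy]; rewrite /preimage/=.
  by rewrite morph0; exact: subgroup0.
by rewrite morphB; exact: subgroupB.
Qed.

Lemma subgroup_image V : is_subgroup V -> is_subgroup (f @` V).
Proof.
move=> sV; split; first by exists 0; [exact: subgroup0|exact: morph0].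
move=> _ _ [x Vx <-] [y Vy <-]; exists (x - y); last by rewrite morphB.
exact: subgroupB.
Qed.

Lemma fi_subgroup_preimage V : fi_subgroup V -> fi_subgroup (f @^-1` V).
Proof.
move=> fV; split; first exact: subgroup_preimage fV.1.
have [t [_ tW _ covt]] := transversal_exists (range f) V fV.
have /choice[g gP] y : exists x, y \in t -> f x = y.
  have [/tW[x _ <-]|] := boolP (y \in t); first by exists x.
  by exists 0.
exists [seq g y | y <- t] => x.
have [|y yt Vy] := covt (f x); first by exists x.
exists (g y); first exact: map_f.
by rewrite /preimage/= morphB gP.
Qed.

Lemma fi_subgroup_image V : (forall y, exists x, f x = y) ->
  fi_subgroup V -> fi_subgroup (f @` V).
Proof.
move=> fs fV; split; first exact: subgroup_image fV.1.
have [t tV] := fV.2; exists [seq f x | x <- t] => y.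
have [x <-] := fs y; have [z zt Vxz] := tV x.
exists (f z); first exact: map_f.
by exists (x - z) => //; rewrite morphB.
Qed.

(** [f] sends a transversal of [W] modulo [V] to a list in [W'] that is still separated, modulo
    [V']. *)
Lemma index_le_inj W V W' V' : fi_subgroup V -> fi_subgroup V' ->
  is_subgroup W -> (forall x, W x -> W' (f x)) ->
  (forall x, W x -> V' (f x) -> V x) -> (sgindex W V <= sgindex W' V')%N.
Proof.
move=> fV fV' sW fW fV'V.
have [s ts] := transversal_exists W V fV.
rewrite (index_transversal _ _ _ fV.1 ts) -(size_map f).
case: ts => us sW' seps _.
have sepf x y : x \in s -> y \in s -> V' (f x - f y) -> x = y.
  move=> xs ys; rewrite -morphB => V'xy; apply: seps => //; apply: fV'V => //.
  by apply: subgroupB => //; exact: sW'.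
apply: separated_le_index => //.
- rewrite map_inj_in_uniq // => x y xs ys fxy; apply: sepf => //.
  by rewrite fxy subrr; exact: subgroup0 fV'.1.
- by move=> _ /mapP[x xs ->]; exact/fW/sW'.
- by move=> _ _ /mapP[x xs ->] /mapP[y ys ->] /sepf ->.
Qed.

Lemma index_le_surj W V W' V' : fi_subgroup V -> fi_subgroup V' ->
  (forall y, W' y -> exists2 x, W x & f x = y) ->
  (forall x, V x -> V' (f x)) -> (sgindex W' V' <= sgindex W V)%N.
Proof.
move=> fV fV' fW fVV'.
have [s ts] := transversal_exists W V fV.
rewrite (index_transversal _ _ _ fV.1 ts) -(size_map f).
case: ts => _ _ _ covs; apply: index_le_cover => // _ /fW[x Wx <-].
have [y ys Vxy] := covs x Wx; exists (f y); first exact: map_f.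
by rewrite -morphB; exact: fVV'.
Qed.

Lemma index_preimage V : (forall y, exists x, f x = y) -> fi_subgroup V ->
  sgindex setT (f @^-1` V) = sgindex setT V.
Proof.
move=> fs fV; have fpV := fi_subgroup_preimage _ fV.
apply/eqP; rewrite eqn_leq index_le_inj // index_le_surj // => y _.
by have [x <-] := fs y; exists x.
Qed.

End Morphism.

End Index.

(** * Growth of indices along orbits *)

Section Growth.
Context {X : zmodType}.
Implicit Types (U V W : set X) (T a b : X -> X).

(** For additive [T] and a subgroup [U] this is the subgroup U_L of the overview; its cosets are the
    nonempty atoms of the join of the partitions into cosets of T^-j U, j < L. *)
Definition stay T U (L : nat) : set X :=
  [set x | forall j, (j < L)%N -> U (iter j T x)].

Lemma iter_morph T : {morph T : x y / x + y} ->
  forall j, {morph iter j T : x y / x + y}.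
Proof. by move=> TD; elim=> [|j IH] x y //=; rewrite IH TD. Qed.

Lemma iter_comm T a : (forall x, a (T x) = T (a x)) ->
  forall j x, a (iter j T x) = iter j T (a x).
Proof. by move=> aT; elim=> [|j IH] x //=; rewrite aT IH. Qed.

Lemma iter_surj T : (forall y, exists x, T x = y) ->
  forall j y, exists x, iter j T x = y.
Proof.
move=> Ts; elim=> [|j IH] y; first by exists y.
by have [z <-] := Ts y; have [x <-] := IH z; exists x.
Qed.

Lemma stay0 T U : stay T U 0 = setT.
Proof. by apply/seteqP; split. Qed.

Lemma stayS T U L : stay T U L.+1 = stay T U L `&` iter L T @^-1` U.
Proof.
apply/seteqP; split=> [x Ux|x [Ux UL] j].
  by split=> [j jL|]; apply: Ux => //; rewrite ltnS ltnW.
by rewrite ltnS leq_eqVlt => /predU1P[->|/Ux].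
Qed.

Lemma stay_le T U L M : (L <= M)%N -> stay T U M `<=` stay T U L.
Proof. by move=> LM x Ux j jL; apply: Ux; exact: leq_trans LM. Qed.

Lemma stay_subset T U V L : U `<=` V -> stay T U L `<=` stay T V L.
Proof. by move=> UV x Ux j /Ux/UV. Qed.

Section Morphism.
Variable T : X -> X.
Hypothesis TD : {morph T : x y / x + y}.

Lemma subgroup_stay U L : is_subgroup U -> is_subgroup (stay T U L).
Proof.
move=> sU; elim: L => [|L IH]; first by rewrite stay0.
rewrite stayS; apply: subgroupI => //.
by apply: subgroup_preimage => //; exact: iter_morph.
Qed.

Lemma fi_subgroup_stay U L : fi_subgroup U -> fi_subgroup (stay T U L).
Proof.
move=> fU; elim: L => [|L IH].
  by rewrite stay0; apply: fi_subgroupS fU _.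
rewrite stayS; apply: fi_subgroupI => //.
by apply: fi_subgroup_preimage => //; exact: iter_morph.
Qed.

(** [T] maps U_(M+1) into U_M, and a point of U_(M+1) whose image lies in U_(M+1) lies in U_(M+2).
    Hence distinct classes of U_(M+1) modulo U_(M+2) have distinct images modulo U_(M+1). *)
Lemma index_stay_nonincr U L M : fi_subgroup U -> (L <= M)%N ->
  (sgindex (stay T U M) (stay T U M.+1)
   <= sgindex (stay T U L) (stay T U L.+1))%N.
Proof.
move=> fU; elim: M => [|M IH]; first by case: L.
rewrite leq_eqVlt => /predU1P[->//|]; rewrite ltnS => /IH; apply: leq_trans.
apply: (index_le_inj _ TD).
- exact: fi_subgroup_stay.
- exact: fi_subgroup_stay.
- by apply: subgroup_stay; exact: fU.1.
- by move=> x Ux j jM; rewrite -iterSr; exact: Ux.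
- move=> x Ux UTx [|j] jM; first exact: Ux.
  by rewrite iterSr; exact: UTx.
Qed.

Lemma index_stayS U L : fi_subgroup U ->
  sgindex setT (stay T U L.+1) =
  (sgindex setT (stay T U L) * sgindex (stay T U L) (stay T U L.+1))%N.
Proof.
move=> fU; apply: index_mul => //.
- exact: fi_subgroup_stay.
- by apply: subgroup_stay; exact: fU.1.
- exact: stay_le.
Qed.

(* Here ln q is the entropy of T relative to U; q is the eventual value of the
   nonincreasing sequence of indices [stay T U L : stay T U L.+1]. *)
Lemma stay_growth U : fi_subgroup U -> exists q C : nat, forall L,
  (q ^ L <= sgindex setT (stay T U L) <= C * q ^ L)%N.
Proof.
move=> fU; pose d L := sgindex (stay T U L) (stay T U L.+1).
have Pd : exists n, `[< exists L, d L = n >] by exists (d 0%N); apply/asboolP; exists 0%N.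
case: (ex_minnP Pd) => q /asboolP[N dN] qmin.
have qd L : (q <= d L)%N by apply: qmin; apply/asboolP; exists L.
have dq L : (N <= L)%N -> d L = q.
  by move=> NL; apply/eqP; rewrite eqn_leq qd -dN index_stay_nonincr.
have q0 : (0 < q)%N.
  rewrite -dN; apply: index_gt0; last exact: fi_subgroup_stay.
  by apply: subgroup0; apply: subgroup_stay; exact: fU.1.
have i0 L : (0 < sgindex setT (stay T U L))%N.
  by apply: index_gt0 => //; exact: fi_subgroup_stay.
(* From stage [N] on, each step multiplies the index by exactly [q]; before [N] the index is at most
   its value at [N]. *)
exists q, (sgindex setT (stay T U N)) => L; apply/andP; split.
  elim: L => [|L IH]; first exact: i0.
  by rewrite index_stayS // expnSr; apply: leq_mul => //; exact: qd.
elim: L => [|L IH].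
  rewrite expn0 muln1 stay0; apply: leq_trans (i0 N).
  apply: (index_le_cover _ _ [:: 0]) => [|x _]; first exact: fi_subgroupS fU _.
  by exists 0; rewrite ?inE.
have [NL|LN] := leqP N L.
  rewrite index_stayS // [X in (_ * X)%N](dq L NL) expnSr mulnA.
  by apply: leq_mul.
apply: (@leq_trans (sgindex setT (stay T U N))); last first.
  by rewrite leq_pmulr // expn_gt0 q0.
apply: (index_le_surj (fun x => x)) => //; try exact: fi_subgroup_stay.
  by move=> y _; exists y.
by move=> x; apply: stay_le.
Qed.

(** In [X : U_L] = [X : U0_L] [U0_L : U_L] the first factor is at least q^L, which cancels against
    the upper bound. *)
Lemma index_stay_le U0 U q C L : fi_subgroup U0 -> fi_subgroup U ->
  U `<=` U0 -> (q ^ L <= sgindex setT (stay T U0 L))%N ->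
  (sgindex setT (stay T U L) <= C * q ^ L)%N ->
  (sgindex (stay T U0 L) (stay T U L) <= C)%N.
Proof.
move=> fU0 fU UU0 qU0 UC.
have i0 : (0 < sgindex setT (stay T U0 L))%N.
  by apply: index_gt0 => //; exact: fi_subgroup_stay.
rewrite -(leq_pmul2l i0) -index_mul //; last first.
- exact: stay_subset.
- by apply: subgroup_stay; exact: fU0.1.
- exact: fi_subgroup_stay.
by apply: leq_trans UC _; rewrite mulnC leq_mul.
Qed.

(** The D + 1 points T^i x with i <= D lie in U0_L, since [x] stays in [U0] for L + D steps; at most
    D classes are available. *)
Lemma stay_pigeonhole U0 U D L x : fi_subgroup U ->
  (sgindex (stay T U0 L) (stay T U L) <= D)%N ->
  stay T U0 (L + D) x ->
  exists i m : nat, [/\ (0 < m)%N, (i + m <= D)%N &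
    stay T U L (iter i T x - iter (i + m) T x)].
Proof.
move=> fU iD Ux; apply: contrapT => nim.
have sU : is_subgroup (stay T U L) by apply: subgroup_stay; exact: fU.1.
have sep i j : (i < j <= D)%N -> ~ stay T U L (iter i T x - iter j T x).
  move=> /andP[ij jD] Uij; apply: nim; exists i, (j - i)%N.
  by rewrite subn_gt0 ij subnKC // ltnW.
have inj i j : (i < D.+1)%N -> (j < D.+1)%N ->
    stay T U L (iter i T x - iter j T x) -> i = j.
  move=> iD' jD' Uij; case: (ltngtP i j) => // ij; exfalso.
    by apply: (sep i j) => //; rewrite ij.
  by apply: (sep j i); [rewrite ij|apply: subgroup_subC sU Uij].
have : (size (mkseq (fun i => iter i T x) D.+1) <= sgindex (stay T U0 L) (stay T U L))%N.
  apply: separated_le_index.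
  - exact: fi_subgroup_stay.
  - rewrite map_inj_in_uniq ?iota_uniq // => i j; rewrite !mem_iota /= !add0n => iD' jD' eij.
    by apply: inj => //; rewrite eij subrr; exact: subgroup0.
  - move=> _ /mapP[i + ->] j jL; rewrite mem_iota add0n /= => iD'.
    by rewrite -iterD; apply: Ux; rewrite -addSn leq_add.
  - move=> _ _ /mapP[i + ->] /mapP[j + ->]; rewrite !mem_iota /= !add0n => iD' jD'.
    by move=> /inj ->.
by rewrite size_mkseq => /leq_trans/(_ iD); rewrite ltnn.
Qed.

(* If the index of [stay T U L] in [stay T U0 L] is at most D, the orbit of a
   point of [stay T U0 (L + D)] is, modulo U, periodic of some period m <= D
   from time D on, and m divides D!. *)
Lemma stay_periodic U0 U D : fi_subgroup U ->
  (forall L, (sgindex (stay T U0 L) (stay T U L) <= D)%N) ->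
  forall x, stay T U0 (D + D`! + D) x ->
  U (iter D T (iter D`! T x - x)).
Proof.
move=> fU iD x Ux; have sU := fU.1.
have [i [m [m0 imD Uim]]] := stay_pigeonhole _ _ _ _ x fU (iD _) Ux.
have itB n := morphB _ (iter_morph T TD n).
(* Shifting the pigeonhole congruence by n - i gives this range of n, just long enough for the D!/m
   jumps of length m that start at D. *)
have per n : (D <= n)%N -> (n < D + D`!)%N ->
    U (iter n T x - iter (n + m) T x).
  move=> Dn nD; have iD' : (i <= D)%N by apply: leq_trans imD; exact: leq_addr.
  have /Uim : (n - i < D + D`!)%N by apply: leq_ltn_trans nD; exact: leq_subr.
  by rewrite itB -!iterD addnA subnK // (leq_trans iD').
have [c cm] : exists c, D`! = (c * m)%N.
  by apply/dvdnP; rewrite dvdn_fact // m0 (leq_trans _ imD) // leq_addl.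
have tele e : (e <= c)%N -> U (iter (D + e * m) T x - iter D T x).
  elim: e => [|e IH ec]; first by rewrite mul0n addn0 subrr => _; exact: subgroup0 sU.
  apply: (subgroup_sub_trans _ _ _ _ sU _ (IH (ltnW ec))); apply: (subgroup_subC _ _ _ sU).
  rewrite mulSn (addnC m) addnA; apply: per; first exact: leq_addr.
  by rewrite cm ltn_add2l ltn_pmul2r.
rewrite itB -iterD [in X in iter X]cm.
exact: tele.
Qed.

End Morphism.

(** [g] maps U0_L onto [V] and commutes with [a], so it induces a surjection on classes. The bound
    is free of [g], hence uniform over the subgroups [V] obtained in this way. *)
Lemma index_image_stay T a g U0 L : {morph T : x y / x + y} ->
  {morph a : x y / x + y} -> {morph g : x y / x + y} ->
  (forall x, a (T x) = T (a x)) -> (forall x, a (g x) = g (a x)) ->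
  (forall y, exists x, g x = y) -> fi_subgroup U0 ->
  let V := g @` stay T U0 L in
  (sgindex V (V `&` a @^-1` V) <=
   sgindex (stay T U0 L) (stay T (U0 `&` a @^-1` U0) L))%N.
Proof.
move=> TD aD gD aT ag gs fU0; set V := g @` _; hnf.
have fU1 : fi_subgroup (U0 `&` a @^-1` U0).
  by apply: fi_subgroupI => //; exact: fi_subgroup_preimage.
have fV : fi_subgroup V.
  by apply: fi_subgroup_image => //; exact: fi_subgroup_stay.
apply: (index_le_surj _ gD).
- exact: fi_subgroup_stay.
- by apply: fi_subgroupI => //; exact: fi_subgroup_preimage.
- by [].
- move=> x Ux; split; first by exists x => // j /Ux[].
  rewrite /preimage/= ag; exists (a x) => // j jL.
  by rewrite -iter_comm //; have [] := Ux j jL.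
Qed.

(** Intersect further with the preimage of [V] under [b]: the first layer of the tower has the index
    for [b], and [b] carries the second injectively into the classes for [a]. *)
Lemma index_comp_le a b V : {morph a : x y / x + y} -> {morph b : x y / x + y} ->
  fi_subgroup V ->
  (sgindex V (V `&` (a \o b) @^-1` V) <=
   sgindex V (V `&` a @^-1` V) * sgindex V (V `&` b @^-1` V))%N.
Proof.
move=> aD bD fV.
have fI c : {morph c : x y / x + y} -> fi_subgroup (V `&` c @^-1` V).
  by move=> cD; apply: fi_subgroupI => //; exact: fi_subgroup_preimage.
have abD : {morph a \o b : x y / x + y} by move=> x y /=; rewrite bD aD.
have fB := fi_subgroupI _ _ (fI b bD) (fI _ abD).
apply: (@leq_trans (sgindex V ((V `&` b @^-1` V) `&` (V `&` (a \o b) @^-1` V)))).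
  apply: (index_le_surj (fun x => x)) => //; first exact: fI.
    by move=> y Vy; exists y.
  by move=> x [].
have -> := index_mul _ (V `&` b @^-1` V) V fB (fI b bD).1 fV.1; try by move=> x [].
rewrite mulnC leq_mul //; apply: (index_le_inj _ bD) => //.
- exact: fI.
- by have [] := fI b bD.
- by move=> x [].
- by move=> x [Vx Vbx] [_ Vabx].
Qed.

(* The preimage Z of V under the surjection x |-> S x - x has the index of V and
   contains both V `&` S @^-1` V and the fixed points, so that
   [Z : V `&` S @^-1` V] = [V : V `&` S @^-1` V]. *)
Lemma fixed_points_le S V s : {morph S : x y / x + y} ->
  (forall y, exists x, S x - x = y) -> fi_subgroup V ->
  uniq s -> (forall x, x \in s -> S x = x) -> separated_mod V s ->
  (size s <= sgindex V (V `&` S @^-1` V))%N.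
Proof.
move=> SD Ss fV us sS seps.
pose f x := S x - x.
have fD : {morph f : x y / x + y} by move=> x y; rewrite /f SD opprD addrACA.
have fZ := fi_subgroup_preimage _ fD _ fV.
have fI : fi_subgroup (V `&` S @^-1` V).
  by apply: fi_subgroupI => //; exact: fi_subgroup_preimage.
have eqi : sgindex V (V `&` S @^-1` V) = sgindex (f @^-1` V) (V `&` S @^-1` V).
  have i0 : (0 < sgindex setT V)%N by apply: index_gt0.
  apply/eqP; rewrite -(eqn_pmul2l i0) -index_mul //; last exact: fV.1.
  rewrite -{1}(index_preimage _ fD V Ss fV) -index_mul //; first exact: fZ.1.
  by move=> x [Vx VSx]; apply: subgroupB => //; exact: fV.1.
rewrite eqi; apply: separated_le_index => //.
- move=> x /sS Sx; rewrite /preimage/= /f Sx subrr; exact: subgroup0 fV.1.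
- by move=> x y xs ys [Vxy _]; exact: seps.
Qed.

End Growth.

(** * Open subgroups of a profinite group *)

Section CompactGroup.
Context {X : topologicalZmodType}.
Implicit Types (U V A : set X).

Definition open_subgroup U := is_subgroup U /\ open U.

Lemma continuous_addl (x : X) : continuous (fun y : X => x + y).
Proof.
move=> y; apply: (@continuous_comp _ _ _ (fun y : X => (x, y)) (fun z : X * X => z.1 + z.2)).
  by apply: cvg_pair => //=; exact: cvg_cst.
exact: add_continuous.
Qed.

Lemma continuous_subr (x : X) : continuous (fun y : X => y - x).
Proof.
move=> y; apply: (@continuous_comp _ _ _ (fun y : X => (y, x)) (fun z : X * X => z.1 - z.2)).
  by apply: cvg_pair => //=; exact: cvg_cst.
exact: sub_continuous.
Qed.

Lemma open_coset U x : open U -> open [set y | U (y - x)].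
Proof. by move=> oU; apply: open_comp => // y _; exact: continuous_subr. Qed.

Lemma subgroup_nbhs0_open U : is_subgroup U -> nbhs 0 U -> open U.
Proof.
move=> sU U0; rewrite openE => x Ux.
have : nbhs x ((fun y => y - x) @^-1` U).
  by apply: continuous_subr; rewrite subrr.
apply: filterS => y /= Uy.
by rewrite -(subrK x y); exact: subgroupD.
Qed.

Lemma open_subgroupI U V :
  open_subgroup U -> open_subgroup V -> open_subgroup (U `&` V).
Proof.
by move=> [sU oU] [sV oV]; split; [exact: subgroupI|exact: openI].
Qed.

Lemma open_subgroup_preimage (f : X -> X) U : {morph f : x y / x + y} -> continuous f ->
  open_subgroup U -> open_subgroup (f @^-1` U).
Proof.
move=> fD fc [sU oU]; split; first exact: subgroup_preimage.
by apply: open_comp => // x _; exact: fc.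
Qed.

Definition stabilizer A : set X := [set x | forall a, A a <-> A (a + x)].

Lemma subgroup_stabilizer A : is_subgroup (stabilizer A).
Proof.
split=> [a|x y Ax Ay a]; first by rewrite addr0.
rewrite addrA; split.
  by move=> /(Ax a) Aax; apply/(Ay (a + x - y)); rewrite subrK.
by move=> /(Ay (a + x - y)); rewrite subrK => /(Ax a).
Qed.

Hypothesis compX : compact [set: X].

Lemma open_subgroup_fi U : open_subgroup U -> fi_subgroup U.
Proof.
move=> [sU oU]; split=> //.
have /compact_near_coveringP ncX := compX.
(* The filter of finite lists directed by inclusion: compactness for it yields one list meeting all
   cosets of [U]. *)
pose F : set_system (seq X) :=
  [set P | exists s0 : seq X, forall s : seq X, {subset s0 <= s} -> P s].
have FF : Filter F.
  split; first by exists [::].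
    move=> P Q [s sP] [t tQ]; exists (s ++ t) => r str.
    by split; [apply: sP|apply: tQ] => x xs; apply: str; rewrite mem_cat xs ?orbT.
  by move=> P Q PQ [s sP]; exists s => r /sP/PQ.
have [x _|s0 s0U] := ncX _ F (fun s x => exists2 y, y \in s & U (x - y)) FF.
  exists ([set y | U (y - x)], [set s | x \in s]).
    split; last by exists [:: x] => s; apply; rewrite mem_head.
    apply: open_nbhs_nbhs; split; first exact: open_coset.
    by rewrite /= subrr; exact: subgroup0 sU.
  by move=> [y s] [/= Uy xs]; exists x.
by exists s0 => x; apply: (s0U s0).
Qed.

(** Since [A] and its complement are open, small translations keep each point on its side;
    compactness makes the smallness uniform. *)
Lemma open_stabilizer A : open A -> closed A -> open_subgroup (stabilizer A).
Proof.
move=> oA cA; split; first exact: subgroup_stabilizer.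
apply: subgroup_nbhs0_open; first exact: subgroup_stabilizer.
have /compact_near_coveringP ncX := compX.
have := ncX X (nbhs (0 : X)) (fun x a => A a <-> A (a + x)) _.
have addP (B : set X) (a : X) : open B -> B a ->
    \forall a' \near a & x \near (0 : X), B a' /\ B (a' + x).
  move=> oB Ba.
  have nB : nbhs a B by exact: open_nbhs_nbhs.
  have h1 : \forall p \near (a, 0 : X), B p.1.
    by exists (B, setT); [split=> //; exact: filterT|move=> [p1 p2] []].
  have h2 : \forall p \near (a, 0 : X), B (p.1 + p.2).
    by apply: (@add_continuous X (a, 0)) => /=; rewrite addr0.
  exact: filterI h1 h2.
move=> /(_ _) H; have {H} : nbhs (0 : X) [set x | setT `<=` (fun a => A a <-> A (a + x))].
  apply: H => a _; have [Aa|nAa] := pselect (A a).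
    by apply: filterS (addP A a oA Aa) => -[a' x] /= [].
  have oC : open (~` A) by rewrite openC.
  by apply: filterS (addP (~` A) a oC nAa) => -[a' x] /= [].
by apply: filterS => x /= H a; exact: H.
Qed.

Hypothesis zdX : zero_dim_clopen_base X.

Lemma open_subgroup_base N : nbhs (0 : X) N ->
  exists2 U, open_subgroup U & U `<=` N.
Proof.
rewrite nbhsE => -[B [oB B0] BN].
have [V [oV cV V0 VB]] := zdX 0 B oB B0.
exists (stabilizer V); first exact: open_stabilizer.
by move=> x Vx; apply/BN/VB; rewrite -[x]add0r; apply/(Vx 0).
Qed.

Hypothesis T1X : forall x : X, open [set y | y <> x].

Lemma open_subgroup_separates (s : seq X) :
  exists2 U, open_subgroup U & separated_mod U s.
Proof.
pose D : seq X := [seq x <- [seq x - y | x <- s, y <- s] | x != 0].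
have : nbhs (0 : X) [set z | forall x, x \in D -> z <> x].
  have : forall x, x \in D -> x <> 0 by move=> x; rewrite mem_filter => /andP[/eqP].
  elim: D => [_|x D IH D0]; first by apply: filterS filterT.
  have N1 : nbhs (0 : X) [set z | z <> x].
    apply: open_nbhs_nbhs; split=> //=; apply/nesym; apply: D0.
    by rewrite inE eqxx.
  have N2 := IH (fun z zD => D0 z (@mem_behead _ (x :: D) z zD)).
  by apply: filterS (filterI N1 N2) => z [zx zD] y; rewrite inE => /predU1P[->//|/zD].
move=> /open_subgroup_base[U oU UD]; exists U => // x y xs ys Uxy.
apply: contrapT => xy; apply: (UD _ Uxy (x - y)) => //.
rewrite mem_filter subr_eq0; apply/andP; split; first exact/eqP.
exact: (allpairs_f (fun a b : X => a - b)).
Qed.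

(** Compactness gives one neighbourhood of 0 that serves all [x], so a whole coset around [y] misses
    the image. *)
Lemma not_in_image_mod (f : X -> X) (y : X) : continuous f -> (forall x, f x <> y) ->
  exists2 U, open_subgroup U & forall x, ~ U (y - f x).
Proof.
move=> fc fy; have /compact_near_coveringP ncX := compX.
have : nbhs (0 : X) [set z | setT `<=` (fun x => f x + z <> y)].
  apply: (ncX X (nbhs (0 : X)) (fun z x => f x + z <> y)) => x _.
  have : nbhs (f x + 0) [set w | w <> y].
    by rewrite addr0; apply: open_nbhs_nbhs; split=> //=; exact: fy.
  move=> /(@add_continuous X (f x, 0)) [[B C] [/= Bfx C0] BC].
  exists (f @^-1` B, C); first by split=> //=; exact: fc.
  by move=> [x' z] [/= Bx' Cz]; apply: (BC (f x', z)).
move=> /open_subgroup_base[U oU UN]; exists U => // x /UN.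
by move=> /(_ x Logic.I); apply; rewrite addrC subrK.
Qed.

Lemma open_stay (T : X -> X) U L : {morph T : x y / x + y} -> continuous T ->
  open_subgroup U -> open_subgroup (stay T U L).
Proof.
move=> TD Tc oU; split; first by apply: subgroup_stay oU.1.
elim: L => [|L IH]; first by rewrite stay0; exact: openT.
rewrite stayS; apply: openI => //; apply: open_comp; last exact: oU.2.
move=> x _; elim: L {IH} x => [|L IH] x; first exact: cvg_id.
by apply: continuous_comp; [exact: IH|exact: Tc].
Qed.

End CompactGroup.

Lemma metrizable_T1 (R : realType) (X : topologicalZmodType) :
  metrizable R X -> forall x : X, open [set y | y <> x].
Proof.
move=> [dist [d0 dE dC dT dO]] x; apply/dO => y yx; exists (dist y x).
  by rewrite lt_neqAle d0 andbT eq_sym; apply/eqP => /dE.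
by move=> z /= dyz zx; rewrite zx ltxx in dyz.
Qed.

(** * Topological entropy *)

Section Entropy.
Context {R : realType} {X : topologicalZmodType}.
Hypothesis compX : compact [set: X].
Variable T : X -> X.
Hypotheses (TD : {morph T : x y / x + y}) (Tc : continuous T).

Definition coset_cover (U : set X) : set (set X) :=
  [set A | exists x, A = [set y | U (y - x)]].

Lemma open_cover_cosets U : open_subgroup U -> open_cover (coset_cover U).
Proof.
move=> [sU oU]; split=> [_ [x ->]|x]; first exact: open_coset.
by exists [set y | U (y - x)]; [exists x|rewrite /= subrr; exact: subgroup0 sU].
Qed.

(** Two points in one piece of the join are congruent modulo U_n, so one point from each nonempty
    piece represents all classes. *)
Lemma index_stay_le_join U n : open_subgroup U ->
  (sgindex setT (stay T U n))%:R <= join_cover_number R T (coset_cover U) n.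
Proof.
move=> oU; have sU := oU.1.
have fS : fi_subgroup (stay T U n).
  by apply: open_subgroup_fi => //; exact: open_stay.
have itB i := morphB _ (iter_morph T TD i).
apply: lb_le_inf.
  (* The infimum must range over a nonempty set: a transversal modulo U_n indexes a finite
     subcover. *)
  have [s [_ _ _ scov]] := transversal_exists setT _ fS.
  exists (size s)%:R, (size s) => //=.
  exists (fun j i => [set y | U (y - iter i T (nth 0 s j))]).
  split=> [j i|x]; first by exists (iter i T (nth 0 s j)).
  have [y ys Uxy] := scov x Logic.I.
  have yj : (index y s < size s)%N by rewrite index_mem.
  exists (Ordinal yj) => i /=; rewrite nth_index // -itB; exact: Uxy.
move=> _ [k [w [wU wcov]] <-]; rewrite ler_nat.
have /choice[p pP] (j : 'I_k) : exists p, (exists x, forall i, w j i (iter i T x)) ->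
    forall i, w j i (iter i T p).
  have [[x xw]|nx] := pselect (exists x, forall i, w j i (iter i T x)).
    by exists x.
  by exists 0.
rewrite -[leqRHS]card_ord cardE -(size_map p).
apply: index_le_cover => // x _; have [j xw] := wcov x.
exists (p j); first by apply/map_f; rewrite mem_enum.
move=> i ltin; have := xw (Ordinal ltin).
have := pP j (ex_intro _ x xw) (Ordinal ltin).
have [c -> /= Up Ux] := wU j (Ordinal ltin).
rewrite itB; apply: (subgroup_sub_trans _ _ _ _ sU Ux).
exact: (subgroup_subC _ _ _ sU Up).
Qed.

Lemma stay_growth_entropy U q : open_subgroup U -> (0 < q)%N ->
  (forall L, (q ^ L <= sgindex setT (stay T U L))%N) ->
  ((ln q%:R)%:E <= topological_entropy R T)%E.
Proof.
move=> oU q0 qU; apply: le_trans; last first.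
  apply: ereal_sup_ubound; exists (coset_cover U) => //.
  exact: open_cover_cosets.
rewrite limn_esup_lim; apply: lime_ge; first exact: is_cvg_esups.
apply: nearW => m; apply: ereal_sup_ge.
(* This index is in the tail from [m] and avoids division by 0. *)
pose n := maxn m 1; exists (ln (join_cover_number R T (coset_cover U) n) / n%:R)%:E.
  by exists n => //=; exact: leq_maxl.
have n0 : (0 < n)%N by rewrite leq_max orbT.
rewrite lee_fin ler_pdivlMr ?ltr0n // mulr_natr -lnXn ?ltr0n //.
have qj : q%:R ^+ n <= join_cover_number R T (coset_cover U) n.
  apply: le_trans (index_stay_le_join U n oU).
  by rewrite -natrX ler_nat.
by rewrite ler_ln // posrE ?exprn_gt0 ?ltr0n // (lt_le_trans _ qj) ?exprn_gt0 ?ltr0n.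
Qed.

Lemma stay_growth_bounded : (topological_entropy R T < +oo)%E ->
  exists K, forall U q, open_subgroup U ->
    (forall L, (q ^ L <= sgindex setT (stay T U L))%N) -> (q <= K)%N.
Proof.
move=> hT; have [r hr] : exists r : R, (topological_entropy R T <= r%:E)%E.
  case: (topological_entropy R T) hT => [r _| |_] //; first by exists r.
  by exists 0; rewrite leNye.
(* ln q <= h(T) <= r gives q <= exp r, and the bound exceeds exp r. *)
exists (Num.bound (expR r)) => U [//|q] oU qU.
rewrite -(ler_nat R) ltW // (le_lt_trans _ (archi_boundP (expR_ge0 r))) //.
rewrite -ler_ln ?posrE ?ltr0n ?expR_gt0 // expRK -lee_fin.
exact: le_trans (stay_growth_entropy U q.+1 oU isT qU) hr.
Qed.

(* U0 of maximal relative entropy: the relative sgindex cannot grow with L. *)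
Lemma max_growth_subgroup : (topological_entropy R T < +oo)%E ->
  exists2 U0, open_subgroup U0 &
    forall U, open_subgroup U -> U `<=` U0 ->
      exists D, forall L, (sgindex (stay T U0 L) (stay T U L) <= D)%N.
Proof.
move=> /stay_growth_bounded[K KP].
pose P q := `[< exists2 U, open_subgroup U &
  forall L, (q ^ L <= sgindex setT (stay T U L))%N >].
have osT : open_subgroup [set: X] by split; [exact: subgroupT|exact: openT].
have fiS U L : open_subgroup U -> fi_subgroup (stay T U L).
  by move=> oU; apply: open_subgroup_fi => //; exact: open_stay.
have P1 : exists q, P q.
  (* The value q = 0 starts the maximization; at L = 0 it still asks for a positive index, as 0^0 =
     1. *)
  exists 0%N; apply/asboolP; exists setT => // L; case: L => [|L].
    by rewrite expn0; apply: index_gt0 => //; exact: fiS.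
  by rewrite exp0n.
have PK q : P q -> (q <= K)%N by move=> /asboolP[U oU] /(KP U q oU).
case: (ex_maxnP P1 PK) => q /asboolP[U0 oU0 qU0] qmax.
exists U0 => // U oU UU0.
have fU0 := open_subgroup_fi compX _ oU0.
have fU := open_subgroup_fi compX _ oU.
have [q' [D q'D]] := stay_growth T TD U fU.
exists D => L; apply: (index_stay_le T TD U0 U q) => //.
(* By maximality the bound D q'^L for [U] is at most D q^L, to be compared with the lower bound q^L
   for [U0]. *)
have q'q : (q' <= q)%N.
  by apply: qmax; apply/asboolP; exists U => // M; have /andP[] := q'D M.
have /andP[_ /leq_trans] := q'D L; apply; rewrite leq_mul2l.
by apply/orP; right; elim: L => // M IH; rewrite !expnS leq_mul.
Qed.

End Entropy.

(** * Haar measure *)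

(** A separate copy of the type, whose measurable sets are the clopen sets rather than the Borel
    sets. *)
Definition clopenX (X : topologicalZmodType) : Type := pointedX X.

Section ClopenAlgebra.
Context {X : topologicalZmodType}.

HB.instance Definition _ := Pointed.on (clopenX X).

Let clopen : set (set (clopenX X)) :=
  [set A | open (A : set X) /\ closed (A : set X)].

Let clopen0 : clopen set0.
Proof. by split; [exact: open0|exact: closed0]. Qed.

Let clopenU : setU_closed clopen.
Proof. by move=> A B [oA cA] [oB cB]; split; [exact: openU|exact: closedU]. Qed.

Let clopenC : setC_closed clopen.
Proof. by move=> A [oA cA]; split; [rewrite openC|rewrite closedC]. Qed.

HB.instance Definition _ := @isAlgebraOfSets.Build default_measure_display
  (clopenX X) clopen clopen0 clopenU clopenC.

End ClopenAlgebra.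

(** * The coset-counting content on clopen sets *)

Section Mass.
Context {R : realType} {X : topologicalZmodType}.
Implicit Types (U V A B : set X) (s t : seq X).

Definition saturated U A := forall x y, U (x - y) -> A x -> A y.

Definition nb_in A s := count (fun x => `[< A x >]) s.

(** [r] is the proportion of the cosets of [U] that are contained in [A]. *)
Definition mass_spec A (r : R) := exists U s,
  [/\ open_subgroup U, saturated U A, transversal setT U s &
      r = (nb_in A s)%:R / (size s)%:R].

Definition mass A : R := xget 0 (mass_spec A).

Lemma saturated_sub U V A : U `<=` V -> saturated V A -> saturated U A.
Proof. by move=> UV VA x y /UV; exact: VA. Qed.

Lemma transversal_size_gt0 U s : transversal setT U s -> (0 < size s)%N.
Proof. by case=> _ _ _ /(_ 0 Logic.I)[y]; case: s. Qed.

Lemma nb_in_transversal U A s t : is_subgroup U -> saturated U A ->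
  transversal setT U s -> transversal setT U t -> nb_in A s = nb_in A t.
Proof.
move=> sU UA; wlog suff le_st : s t / transversal setT U s ->
    transversal setT U t -> (nb_in A s <= nb_in A t)%N.
  by move=> ts tt; apply/eqP; rewrite eqn_leq !le_st.
move=> [us _ seps _] [_ _ _ covt]; rewrite /nb_in -!size_filter.
apply: (separated_size_le U) => //.
- exact: filter_uniq.
- by move=> x y; rewrite !mem_filter => /andP[_ xs] /andP[_ ys]; exact: seps.
- move=> x; rewrite mem_filter => /andP[/asboolP Ax _].
  have [y yt Uxy] := covt x Logic.I; exists y => //.
  by rewrite mem_filter yt andbT; apply/asboolP; exact: UA Uxy Ax.
Qed.

Lemma nb_in_allpairs U A s t : is_subgroup U -> saturated U A ->
  (forall y, y \in t -> U y) ->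
  nb_in A [seq x + y | x <- s, y <- t] = (nb_in A s * size t)%N.
Proof.
move=> sU UA tU; elim: s => //= x s IH.
rewrite mulnDl -IH /nb_in count_cat; congr (_ + _)%N.
rewrite count_map (@eq_in_count _ _ (fun=> `[< A x >])) => [|y yt /=].
  by case: asboolP => _; rewrite ?count_predT ?mul1n ?count_pred0 ?mul0n.
apply/asboolP/asboolP; apply: UA.
  by rewrite addrAC subrr add0r; exact: tU.
by rewrite opprD addrA subrr sub0r; apply: subgroupN => //; exact: tU.
Qed.

(** Each coset of [U] splits into the same number of cosets of [V], all inside [A] or all outside;
    that number cancels. *)
Lemma ratio_refine U V A s t : fi_subgroup U -> fi_subgroup V -> V `<=` U ->
  saturated U A -> transversal setT U s -> transversal setT V t ->
  (nb_in A s)%:R / (size s)%:R = (nb_in A t)%:R / (size t)%:R :> R.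
Proof.
move=> fU fV VU UA ts tt.
have [r tr] := transversal_exists U V fV.
have tsr := transversal_mul V U setT s r fV.1 fU.1 subgroupT VU (fun x _ => Logic.I) ts tr.
have VA := saturated_sub _ _ _ VU UA.
rewrite (nb_in_transversal V A t _ fV.1 VA tt tsr).
rewrite (transversal_size _ _ _ _ fV.1 tt tsr) size_allpairs.
rewrite (nb_in_allpairs U) //; [|exact: fU.1|by case: tr].
have r0 : (size r != 0)%N.
  have := transversal_size_gt0 _ _ tsr.
  by rewrite size_allpairs; case: (size r); rewrite ?muln0.
by rewrite !natrM -mulf_div divff ?mulr1 // pnatr_eq0.
Qed.

Hypothesis compX : compact [set: X].

Lemma mass_spec_uniq A r r' : mass_spec A r -> mass_spec A r' -> r = r'.
Proof.
move=> [U [s [oU UA ts ->]]] [V [t [oV VA tt ->]]].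
have fU := open_subgroup_fi compX _ oU; have fV := open_subgroup_fi compX _ oV.
have fI := fi_subgroupI _ _ fU fV; have [q tq] := transversal_exists setT _ fI.
rewrite (ratio_refine U _ A s q fU fI _ UA ts tq); last by move=> x [].
by rewrite (ratio_refine V _ A t q fV fI _ VA tt tq) // => x [].
Qed.

Lemma massE A r : mass_spec A r -> mass A = r.
Proof.
rewrite /mass; case: xgetP => [r' -> Ar' Ar|nA /nA //].
exact: mass_spec_uniq Ar' Ar.
Qed.

Lemma clopen_saturated A : open A -> closed A ->
  exists2 U, open_subgroup U & saturated U A.
Proof.
move=> oA cA; exists (stabilizer A); first exact: open_stabilizer.
move=> x y Sxy Ax; have sS := @subgroup_stabilizer X A.
by have /(_ x) := subgroup_subC _ _ _ sS Sxy; rewrite addrC subrK => -[+ _]; apply.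
Qed.

Lemma saturated_clopen U A : open_subgroup U -> saturated U A ->
  open A /\ closed A.
Proof.
move=> [sU oU].
have sat_open B : saturated U B -> open B.
  move=> UB; rewrite openE => x Bx.
  have := open_nbhs_nbhs (conj (open_coset U x oU) (_ : U (x - x))).
  rewrite subrr => /(_ (subgroup0 _ sU)); apply: filterS => y Uyx.
  by apply: UB Bx; exact: subgroup_subC.
move=> UA; split; first exact: sat_open.
rewrite -openC; apply: sat_open => x y Uxy nAx Ay; apply: nAx.
by apply: UA Ay; exact: subgroup_subC.
Qed.

Lemma mass_specE A : open A -> closed A -> mass_spec A (mass A).
Proof.
move=> oA cA; have [U oU UA] := clopen_saturated A oA cA.
have [s ts] := transversal_exists setT _ (open_subgroup_fi compX _ oU).
have sA : mass_spec A ((nb_in A s)%:R / (size s)%:R) by exists U, s; split.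
by rewrite (massE _ _ sA).
Qed.

Lemma mass_ge0 A : 0 <= mass A.
Proof.
rewrite /mass; case: xgetP => // r -> [U [s [_ _ _ ->]]].
by rewrite divr_ge0 ?ler0n.
Qed.

Lemma mass0 : mass set0 = 0.
Proof.
have [U [s [_ _ _ ->]]] := mass_specE set0 open0 closed0.
rewrite /nb_in (eq_count (a2 := pred0)) ?count_pred0 ?mul0r // => x.
by apply/asboolP.
Qed.

Lemma massT : mass setT = 1.
Proof.
have [U [s [_ _ ts ->]]] := mass_specE setT openT closedT.
rewrite /nb_in (eq_count (a2 := predT)) ?count_predT.
  by rewrite divff // pnatr_eq0 -lt0n; exact: transversal_size_gt0 ts.
by move=> x; apply/asboolP.
Qed.

Lemma massU A B : open A -> closed A -> open B -> closed B ->
  A `&` B = set0 -> mass (A `|` B) = mass A + mass B.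
Proof.
move=> oA cA oB cB AB0.
have [U oU UA] := clopen_saturated A oA cA.
have [V oV VB] := clopen_saturated B oB cB.
have oW := open_subgroupI _ _ oU oV.
have {}UA : saturated (U `&` V) A by apply: saturated_sub UA => x [].
have {}VB : saturated (U `&` V) B by apply: saturated_sub VB => x [].
have [s ts] := transversal_exists setT _ (open_subgroup_fi compX _ oW).
have sat C : saturated (U `&` V) C -> mass C = (nb_in C s)%:R / (size s)%:R.
  by move=> WC; apply: massE; exists (U `&` V), s; split.
rewrite !sat //; last first.
  by move=> x y Wxy [Ax|Bx]; [left; exact: UA Wxy Ax|right; exact: VB Wxy Bx].
rewrite -mulrDl -natrD; congr (_%:R / _).
rewrite /nb_in -count_predUI [count (predI _ _) _](_ : _ = 0%N) ?addn0.
  apply: eq_count => x /=.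
  by apply/asboolP/orP => -[/asboolP|/asboolP]; rewrite /=; tauto.
apply/eqP; rewrite -leqn0 -ltnS ltnNge -has_count; apply/hasP => -[x _ /=].
by move=> /andP[/asboolP Ax /asboolP Bx]; have : (A `&` B) x by []; rewrite AB0.
Qed.

Lemma mass_translate A x : open A -> closed A ->
  mass ((fun y => x + y) @^-1` A) = mass A.
Proof.
move=> oA cA; have [U [s [oU UA [us _ seps covs] ->]]] := mass_specE A oA cA.
apply: massE; exists U, [seq - x + y | y <- s]; split=> //.
- move=> y z Uyz; apply: UA.
  by rewrite opprD addrACA subrr add0r.
- split=> //.
  + by rewrite map_inj_uniq //; exact: addrI.
  + move=> _ _ /mapP[y ys ->] /mapP[z zs ->].
    by rewrite opprD addrACA subrr add0r => /seps ->.
  + move=> y _; have [z zs Uz] := covs (x + y) Logic.I.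
    exists (- x + z); first exact: map_f.
    by rewrite opprD opprK addrA (addrC y).
- rewrite size_map /nb_in count_map; congr (_%:R / _).
  by apply: eq_count => y /=; rewrite /preimage/= addrA subrr add0r.
Qed.

(** Some representative lies in [W], which excludes mass 0; mass 1 puts all representatives, hence
    all cosets, in [W]. *)
Lemma mass_invariant_subgroup W : open_subgroup W ->
  mass W = 0 \/ mass W = 1 -> W = setT.
Proof.
move=> oW; have sW := oW.1.
have [s ts] := transversal_exists setT _ (open_subgroup_fi compX _ oW).
have s0 := transversal_size_gt0 _ _ ts.
have -> : mass W = (nb_in W s)%:R / (size s)%:R.
  apply: massE; exists W, s; split=> // x y Wxy Wx.
  by rewrite -(subKr x y); exact: (subgroupB W x (x - y) sW Wx Wxy).
have sR : (size s)%:R != 0 :> R by rewrite pnatr_eq0 -lt0n.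
case: (ts) => _ _ _ covs; case => [/eqP|/(canRL (divfK sR))/eqP].
  rewrite mulf_eq0 invr_eq0 (negbTE sR) orbF pnatr_eq0 -leqn0 -ltnS ltnNge -has_count.
  have [y ys Wy] := covs 0 Logic.I => /hasP[]; exists y => //; apply/asboolP.
  by rewrite -[y]opprK; apply: subgroupN => //; rewrite -sub0r.
rewrite mul1r eqr_nat /nb_in -all_count => /allP sWs.
apply/seteqP; split=> // x _; have [y /sWs/asboolP Wy Wxy] := covs x Logic.I.
by rewrite -(subrK y x); exact: subgroupD.
Qed.

End Mass.

(** * Extension of the content to a Haar measure *)

Section Haar.
Context {R : realType} {X : topologicalZmodType}.
Hypothesis compX : compact [set: X].

Definition clopen_mass (A : set (clopenX X)) : \bar R := (@mass R X A)%:E.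

Let clopen_mass0 : clopen_mass set0 = 0%E.
Proof. by rewrite /clopen_mass mass0. Qed.

Let clopen_mass_ge0 A : (0 <= clopen_mass A)%E.
Proof. by rewrite lee_fin mass_ge0. Qed.

Let clopen_massU : additive2 clopen_mass.
Proof.
by move=> A B [oA cA] [oB cB] AB0; rewrite /clopen_mass massU // EFinD.
Qed.

(* By compactness a countable partition of a clopen set into clopen sets is
   finite. *)
Let clopen_mass_sigma_additive : semi_sigma_additive clopen_mass.
Proof.
move=> F mF tF mUF.
have [N FN] : exists N, forall k, (N <= k)%N -> F k = set0.
  have /compact_near_coveringP ncX := compX.
  (* A point of the union has the piece containing it as neighbourhood; any other point has the
     complement, open because the union is clopen. *)
  have [x _|N _ NF] := ncX nat \oo
      (fun n x => (\bigcup_k F k) x -> exists2 k, (k < n)%N & F k x) _.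
    have [Fx|nFx] := pselect ((\bigcup_k F k) x).
      have [k _ Fkx] := Fx; exists (F k, [set n | (k < n)%N]).
        split; last by exists k.+1.
        by apply: open_nbhs_nbhs; split=> //; case: (mF k).
      by move=> [y n] [/= Fky kn] _; exists k.
    exists (~` \bigcup_k F k, setT).
      split; last exact: filterT.
      by apply: open_nbhs_nbhs; split=> //; rewrite openC; case: mUF.
    by move=> [y n] [].
  exists N => k Nk; apply/seteqP; split=> // x Fkx.
  have [j jN Fjx] : exists2 j, (j < N)%N & F j x.
    by apply: (NF N) => //=; exists k.
  have jk : j = k by apply: tF => //; exists x.
  by rewrite jk ltnNge Nk in jN.
have UN n : (N <= n)%N -> \sum_(0 <= i < n) clopen_mass (F i) = clopen_mass (\bigcup_k F k).
  move=> Nn; have madd := (additive2P clopen_mass0).2 clopen_massU.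
  rewrite big_mkord -madd //.
    congr clopen_mass; rewrite -bigcup_mkord; apply/seteqP; split=> x [k].
      by exists k.
    move=> _ Fkx; exists k => //=; apply: leq_trans Nn.
    by rewrite ltnNge; apply/negP => /FN Fk0; rewrite Fk0 in Fkx.
  exact: bigsetU_measurable.
apply: cvg_near_cst; exists N => // n /= /UN ->.
Qed.

HB.instance Definition _ := isMeasure.Build _ (clopenX X) R clopen_mass
  clopen_mass0 clopen_mass_ge0 clopen_mass_sigma_additive.

Hypothesis mX : metrizable R X.
Hypothesis zdX : zero_dim_clopen_base X.

(** Metrizability gives a countable base at 0, needed to write open sets as countable unions of
    clopen ones. *)
Lemma open_subgroup_sequence : exists H : nat -> set X,
  (forall n, open_subgroup (H n)) /\
  forall N, nbhs (0 : X) N -> exists n, H n `<=` N.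
Proof.
have [dist [d0 dE dC dT dO]] := mX.
have ballN (n : nat) : nbhs (0 : X) [set y | dist 0 y < n.+1%:R^-1].
  apply: open_nbhs_nbhs; split=> /=; last first.
    by rewrite (dE 0 0).2 // invr_gt0 ltr0n.
  apply/dO => x /= dx; exists (n.+1%:R^-1 - dist 0 x); first by rewrite subr_gt0.
  move=> y /= dxy; apply: le_lt_trans (dT 0 x y) _.
  by rewrite -ltrBrDl.
have /choice[H HP] n : exists U, open_subgroup U /\
    U `<=` [set y | dist 0 y < n.+1%:R^-1].
  by have [U oU UN] := open_subgroup_base compX zdX _ (ballN n); exists U.
exists H; split=> [n|N]; first by case: (HP n).
rewrite nbhsE => -[B [oB B0] BN].
have [e e0 eB] := (dO B).1 oB 0 B0.
have [n _ /(_ n (leqnn n)) ne] := near_infty_natSinv_lt (PosNum e0).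
exists n => x /(HP n).2 /= dx; apply/BN/eB => /=.
exact: lt_trans dx ne.
Qed.

Lemma open_sigma_clopen :
  <<s (@open X : set (set (pointedX X))) >> `<=`
  <<s @measurable _ (clopenX X) >>.
Proof.
apply: smallest_sub; first exact: smallest_sigma_algebra.
move=> A oA; have [H [oH HN]] := open_subgroup_sequence.
(* The union of the cosets of [H n] contained in [A], which is clopen. *)
pose B n : set X := [set x | [set y | H n (y - x)] `<=` A].
have -> : A = \bigcup_n B n.
  apply/seteqP; split=> [x Ax|x [n _ Bx]]; last first.
    by apply: Bx; rewrite /= subrr; exact: subgroup0 (oH n).1.
  have [|n Hn] := HN [set z | A (x + z)].
    by apply: (continuous_addl x 0); rewrite /= addr0; exact: open_nbhs_nbhs.
  exists n => // y /= /Hn /=; by rewrite addrC subrK.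
apply: (@sigma_algebra_bigcup _ setT) => n; apply: sub_sigma_algebra.
apply: (saturated_clopen (H n)) => // x y Hxy Bx z /= Hz; apply: Bx => /=.
apply: (subgroup_sub_trans _ _ _ _ (oH n).1 Hz).
exact: (subgroup_subC _ _ _ (oH n).1 Hxy).
Qed.

Let borelX := g_sigma_algebraType (@open X : set (set (pointedX X))).

Definition haar (A : set borelX) : \bar R :=
  measure_extension (clopen_mass : {measure set (clopenX X) -> \bar R}) A.

Let haar0 : haar set0 = 0%E.
Proof. exact: measure0. Qed.

Let haar_ge0 A : (0 <= haar A)%E.
Proof. exact: measure_ge0. Qed.

Let haar_sigma_additive : semi_sigma_additive haar.
Proof.
move=> F mF tF mUF.
apply: (@measure_semi_sigma_additive _ _ _ (measure_extension
  (clopen_mass : {measure set (clopenX X) -> \bar R}))) => //.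
  by move=> i; exact: open_sigma_clopen (mF i).
exact: open_sigma_clopen mUF.
Qed.

HB.instance Definition _ := isMeasure.Build _ borelX R haar
  haar0 haar_ge0 haar_sigma_additive.

Lemma haarE A : open A -> closed A -> haar A = (mass A)%:E.
Proof. by move=> oA cA; rewrite /haar/= /measure_extension measurable_mu_extE. Qed.

(* The outer measure is invariant: translates of clopen covers are clopen
   covers of the same total mass. *)
Lemma haar_translate_le (x : X) (A : set X) :
  (haar ((fun y : X => (x + y)%R) @^-1` A) <= haar A)%E.
Proof.
apply: le_ereal_inf_tmp => _ [F [mF AF] <-].
apply: ereal_inf_lbound.
have mtF k : @measurable _ (clopenX X) ((fun y : X => x + y) @^-1` F k).
  have [oF cF] := mF k; have c := continuous_addl x.
  by split; [apply: open_comp => // y _; exact: c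
            |apply: closed_comp => // y _; exact: c].
exists (fun k => (fun y : X => x + y) @^-1` F k).
  by split=> // y /AF[k _ Fk]; exists k.
apply: eq_eseriesr => k _; congr (_%:E).
by have [oF cF] := mF k; exact: mass_translate.
Qed.

Lemma haar_probabilityP : haar_probability (haar : {measure set borelX -> \bar R}).
Proof.
split; first by have := haarE setT openT closedT; rewrite massT.
move=> x A _; apply/eqP; rewrite eq_le; apply/andP; split.
  exact: haar_translate_le.
have := haar_translate_le (- x) ((fun y : X => x + y) @^-1` A).
have -> // : (fun y : X => - x + y) @^-1` ((fun y : X => x + y) @^-1` A) = A.
by apply/funext => y; rewrite /preimage/= addrA subrr add0r.
Qed.

(** Ergodicity is quantified over Haar probabilities; the measure just built makes it applicable. *)
Lemma haar_ergodic_invariant (T : X -> X) (W : set X) : haar_ergodic R T -> open_subgroup W ->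
  T @^-1` W = W -> W = setT.
Proof.
move=> ergT oW TW; have [oW' cW] : open W /\ closed W.
  apply: (saturated_clopen W) => // x y Wxy Wx.
  by rewrite -(subKr x y); exact: (subgroupB W x (x - y) oW.1 Wx Wxy).
apply: (mass_invariant_subgroup (R := R) compX) => //.
have mW : <<s (@open X : set (set (pointedX X))) >> W by exact: sub_sigma_algebra.
have := ergT _ haar_probabilityP W mW TW.
by have /= -> := haarE W oW' cW => -[[->]|[->]]; [left|right].
Qed.

End Haar.

(** * Periodic points *)

(* If x |-> T^k x - x missed a point, it would miss an open coset, so its image
   would lie in a proper open subgroup W0; the finite intersection of the T^-j W0
   would then be a proper open T-invariant subgroup. *)
Lemma ergodic_iter_sub_surj (R : realType) (X : topologicalZmodType)
    (T : X -> X) (k : nat) :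
  compact [set: X] -> metrizable R X -> zero_dim_clopen_base X ->
  {morph T : x y / x + y} -> continuous T -> haar_ergodic R T ->
  forall y, exists x, iter k.+1 T x - x = y.
Proof.
move=> compX mX zdX TD Tc ergT y; apply: contrapT => ny.
pose f x := iter k.+1 T x - x.
have fD : {morph f : x y / x + y}.
  by move=> a b; rewrite /f (iter_morph T TD) opprD addrACA.
have itc j : continuous (iter j T).
  elim: j => [|j IH] x; first exact: cvg_id.
  by apply: continuous_comp; [exact: IH|exact: Tc].
have fc : continuous f.
  move=> x; apply: (@continuous_comp _ _ _ (fun x : X => (iter k.+1 T x, x))
    (fun z : X * X => z.1 - z.2)); last exact: sub_continuous.
  by apply: cvg_pair => //=; exact: (itc k.+1).
have [|U oU Uf] := not_in_image_mod compX zdX (metrizable_T1 R X mX) f y fc.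
  by move=> x fx; apply: ny; exists x.
(* The image of [f] enlarged by [U]; it still misses [y]. *)
have sU := oU.1; pose W0 : set X := [set z | exists x, U (z - f x)].
have sW0 : is_subgroup W0.
  split=> [|a b [x Ux] [z Uz]]; first by exists 0; rewrite (morph0 f fD) subrr; exact: subgroup0 sU.
  exists (x - z); rewrite (morphB f fD).
  have -> : a - b - (f x - f z) = (a - f x) - (b - f z) by rewrite !opprD !opprK addrACA.
  exact: subgroupB.
have oW0 : open_subgroup W0.
  split=> //; apply: subgroup_nbhs0_open => //.
  apply: filterS (open_nbhs_nbhs (conj oU.2 (subgroup0 _ sU))) => z Uz.
  by exists 0; rewrite (morph0 f fD) subr0.
have fW0 z : W0 (f z) by exists z; rewrite subrr; exact: subgroup0 sU.
(* Since T^(k+1) z - z lies in [W0], orbits are periodic modulo [W0] with period k + 1, so [T]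
   permutes the defining conditions cyclically. *)
have WT : stay T W0 k.+1 = setT.
  apply: (haar_ergodic_invariant compX mX zdX T) => //; first exact: open_stay.
  apply/seteqP; split=> z Wz j jk.
    case: j jk => [_|j jk]; last by rewrite iterSr; apply: Wz; exact: ltnW.
    rewrite /= -(subKr (iter k.+1 T z) z); apply: subgroupB => //; last exact: fW0.
    by rewrite iterSr; exact: Wz.
  rewrite -iterSr; move: jk; rewrite ltnS leq_eqVlt => /predU1P[->|jk]; last exact: Wz.
  rewrite -(subrK z (iter _ T z)); apply: subgroupD => //; first exact: fW0.
  exact: (Wz 0%N).
have : stay T W0 k.+1 y by rewrite WT.
by move=> /(_ 0%N isT) [x] /Uf.
Qed.

(** [n] is a sum of as many signed basis vectors as the exponent says, each costing a factor at most
    [K]. *)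
Lemma submult_rV_bound (d K : nat) (r : 'rV[int]_d -> nat) :
  (0 < K)%N -> (r 0%R <= 1)%N -> (forall m n, (r (m + n)%R <= r m * r n)%N) ->
  (forall i, (r (delta_mx ord0 i) <= K)%N /\ (r (- delta_mx ord0 i)%R <= K)%N) ->
  forall n, (r n <= K ^ (\sum_(i < d) `|n ord0 i|))%N.
Proof.
move=> K0 r0 rM rK n.
have rZ (v : 'rV[int]_d) (k : nat) : (r v <= K)%N -> (r (v *+ k)%R <= K ^ k)%N.
  move=> rv; elim: k => [|k IH]; first by rewrite mulr0n.
  by rewrite mulrS expnS (leq_trans (rM _ _)) // leq_mul.
rewrite {1}(matrix_sum_delta n) big_ord1.
elim/big_ind2: _ => // [m1 v1 m2 v2 h1 h2|i _].
  by rewrite expnD (leq_trans (rM _ _)) // leq_mul.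
have [rp rn] := rK i; case: (n ord0 i) => k.
  by rewrite (_ : Posz k *: _ = delta_mx ord0 i *+ k); [exact: rZ|rewrite -scaler_nat natz].
rewrite (_ : Negz k *: _ = (- delta_mx ord0 i) *+ k.+1); first exact: rZ.
by rewrite NegzE scaleNr mulNrn -scaler_nat natz.
Qed.

(** Each of the [d] coordinates is at most the norm in absolute value. *)
Lemma sum_abs_le_norm (R : realType) (d : nat) (n : 'rV[int]_d) :
  (\sum_(i < d) `|n ord0 i|)%N%:R <= d%:R * euclid_norm R n.
Proof.
rewrite natr_sum -[d in d%:R]card_ord mulr_natl -sumr_const.
apply: ler_sum => i _.
rewrite [leLHS](_ : _ = `|(n ord0 i)%:~R|); last by rewrite natr_absz intr_norm.
rewrite -sqrtr_sqr ler_wsqrtr // (bigD1 i) //= lerDl.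
by apply: sumr_ge0 => j _; exact: sqr_ge0.
Qed.

(** Bounding every duplicate-free list of fixed points expresses both that the fixed points are
    finite in number and that their number obeys the estimate. *)
Theorem theorem2p2 (R : realType) (X : topologicalZmodType) (d : nat)
  (alpha : 'rV[int]_d -> X -> X) :
  compact [set: X] -> metrizable R X -> zero_dim_clopen_base X ->
  Zd_action_by_cont_automorphisms alpha ->
  entropy_rank_one R alpha ->
  exists2 C : R, 0 < C &
    forall n : 'rV[int]_d, haar_ergodic R (alpha n) ->
      forall s : seq X, uniq s -> (forall x, x \in s -> alpha n x = x) ->
        (size s)%:R <= C `^ (euclid_norm R n).
Proof.
move=> compX mX zdX [a0 aadd aD ac] ent.
have [[n0 erg0]|noerg] := pselect (exists n, haar_ergodic R (alpha n)); last first.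
  by exists 1 => // n ergn; case: noerg; exists n.
have asurj n y : exists x, alpha n x = y.
  by exists (alpha (- n) y); rewrite -aadd subrr a0.
have acomm m n x : alpha m (alpha n x) = alpha n (alpha m x).
  by rewrite -!aadd addrC.
have aDn n : {morph alpha n : x y / x + y} by move=> x y; exact: aD.
pose T := alpha n0.
have [U0 oU0 U0max] := max_growth_subgroup compX T (aDn n0) (ac n0) (ent n0).
have fU0 := open_subgroup_fi compX _ oU0.
(* [D n] is fixed before any small subgroup is chosen, which makes the final constant uniform. *)
have /choice[D DP] n : exists D, forall L,
    (sgindex (stay T U0 L) (stay T (U0 `&` alpha n @^-1` U0) L) <= D)%N.
  apply: U0max => [|x []] //.
  by apply: open_subgroupI => //; exact: open_subgroup_preimage.
have small U : open_subgroup U -> exists V, [/\ fi_subgroup V, V `<=` U &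
    forall n, (sgindex V (V `&` alpha n @^-1` V) <= D n)%N].
  move=> oU; have oUU0 := open_subgroupI _ _ oU oU0.
  have [|E EP] := U0max _ oUU0; first by move=> x [].
  (* By [stay_periodic], [g] maps a long enough stay set of [U0] into [U]; it is onto because [T] is
     bijective and T^(E!) - 1 is onto by ergodicity. *)
  pose g x := iter E T (iter E`! T x - x).
  have gD : {morph g : x y / x + y}.
    move=> x y; rewrite /g -(iter_morph T (aDn n0) E); congr (iter E T _).
    by rewrite (iter_morph T (aDn n0) E`!) opprD addrACA.
  have gs y : exists x, g x = y.
    have [z <-] := iter_surj T (asurj n0) E y.
    have := ergodic_iter_sub_surj R X T E`!.-1 compX mX zdX (aDn n0) (ac n0) erg0 z.
    by rewrite prednK ?fact_gt0 // => -[x <-]; exists x.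
  exists (g @` stay T U0 (E + E`! + E)); split.
  - by apply: fi_subgroup_image => //; exact: (fi_subgroup_stay T (aDn n0)).
  - move=> _ [x Ux <-].
    by have [] := stay_periodic T (aDn n0) U0 _ E (open_subgroup_fi compX _ oUU0) EP x Ux.
  - move=> n; apply: leq_trans (DP n (E + E`! + E)%N).
    apply: (index_image_stay T _ g U0 _ (aDn n0) (aDn n) gD _ _ gs fU0) => x.
      exact: acomm.
    have aiter j z : alpha n (iter j T z) = iter j T (alpha n z).
      by apply: iter_comm => t; exact: acomm.
    by rewrite /g aiter (morphB _ (aDn n)) aiter.
(* The maximum with 1 keeps [K] positive even for d = 0. *)
pose K := maxn 1 (\max_(i < d) maxn (D (delta_mx ord0 i)) (D (- delta_mx ord0 i)%R)).
have K0 : (0 < K)%N by rewrite leq_max.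
(* The exponent [d] comes from comparing the sum of the |n_i| with the Euclidean norm. *)
exists ((K ^ d)%:R); first by rewrite ltr0n expn_gt0 K0.
move=> n ergn s us sfix.
(* [U] and [V] depend on the list [s], whereas [K] does not. *)
have [U oU sepU] := open_subgroup_separates compX zdX (metrizable_T1 R X mX) s.
have [V [fV VU VD]] := small U oU.
have sizes : (size s <= K ^ (\sum_(i < d) `|n ord0 i|))%N.
  apply: (@leq_trans (sgindex V (V `&` alpha n @^-1` V))).
    apply: fixed_points_le => //.
      exact: (ergodic_iter_sub_surj R X (alpha n) 0).
    by move=> x y xs ys /VU; exact: sepU.
  pose r n := sgindex V (V `&` alpha n @^-1` V).
  apply: (submult_rV_bound d K r) => //.
  - rewrite /r (_ : V `&` _ = V).
      apply: (index_le_cover _ _ [:: 0]) => // x Vx; exists 0; rewrite ?inE //.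
      by rewrite subr0.
    by apply/seteqP; split=> [x []//|x Vx]; split=> //; rewrite /preimage/= a0.
  - move=> m1 m2; rewrite /r.
    have -> : alpha (m1 + m2) = alpha m1 \o alpha m2 by apply/funext => x; exact: aadd.
    exact: index_comp_le.
  - move=> i; have := leq_bigmax (F := fun i => maxn (D (delta_mx ord0 i)) (D (- delta_mx ord0 i)%R)) i.
    rewrite geq_max => /andP[D1 D2].
    by split; apply: (leq_trans (VD _)); rewrite leq_max ?D1 ?D2 orbT.
have K1 : (1 : R) <= K%:R by rewrite ler1n.
rewrite natrX -powR_mulrn ?ler0n // -powRrM.
apply: (@le_trans _ _ (K%:R `^ (\sum_(i < d) `|n ord0 i|)%N%:R)).
  by rewrite powR_mulrn ?ler0n // -natrX ler_nat.
exact/ler_powR/sum_abs_le_norm.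
Qed.
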